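(* Let $m\ge 1$ be an integer with $\gcd(3,m)=1$, let $\Bbbk$ be a field, and let $T=\Bbbk[x_1,x_2,x_3]$ be graded by the weights $\operatorname{wt}(x_1)=3$, $\operatorname{wt}(x_2)=3+m$, $\operatorname{wt}(x_3)=3+2m$. Let $\mathfrak p\subset T$ be the defining ideal of the monomial curve parametrized by $(t^{3},t^{3+m},t^{3+2m})$. Then $$\rho(\mathfrak p)\le\frac{\operatorname{reg}(\mathfrak p)}{\gamma(\mathfrak p)}.$$
   Context: $\mathfrak p$ is the kernel of the $\Bbbk$-algebra map $T\to\Bbbk[t]$, $x_1\mapsto t^3$, $x_2\mapsto t^{3+m}$, $x_3\mapsto t^{3+2m}$; it and its symbolic powers $\mathfrak p^{(n)}=\mathfrak p^nT_{\mathfrak p}\cap T$ are homogeneous for the weighted grading. The resurgence is $\rho(\mathfrak p)=\sup\{\,n/r : n,r\ge 1,\ \mathfrak p^{(n)}\not\subseteq\mathfrak p^r\,\}$. For a nonzero weighted homogeneous ideal $I$, $\alpha(I)$ is the least weighted degree of a nonzero homogeneous element of $I$, and the Waldschmidt constant is $\gamma(I)=\lim_{n\to\infty}\alpha(I^{(n)})/n$. For a finitely generated graded $T$-module $M$ with minimal graded free resolution $F_\bullet$, $F_i=\bigoplus_jT(-b_{ij})$, $\operatorname{reg}(M)=\max_{i,j}\{b_{ij}-i\}$ (weighted shifts). *)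

(* Defs.v *)
From HB Require Import structures.
From mathcomp Require Import all_boot all_order all_algebra.
(* The notations of mpoly clash with those of the analysis library. *)
From mathcomp Require Import -(notations) mpoly.
From mathcomp Require Import all_classical all_reals all_analysis.

Set Implicit Arguments.
Unset Strict Implicit.
Unset Printing Implicit Defensive.

Import Order.TTheory GRing.Theory Num.Theory.
Import numFieldNormedType.Exports.

Local Open Scope classical_set_scope.
Local Open Scope ring_scope.

Section WeightedDegree.
Variables (n : nat) (w : 'I_n -> nat).

Definition wdeg (mon : multinom n) : nat := (\sum_(i < n) mon i * w i)%N.

Lemma wdeg0 : wdeg (@mnm0 n) = 0%N.
Proof. by rewrite /wdeg big1 // => i _; rewrite mnm0E. Qed.

Lemma wdegD : {morph wdeg : a b / mnm_add a b >-> (a + b)%N}.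
Proof.
move=> a b; rewrite /wdeg -big_split; apply: eq_bigr => i _.
by rewrite mnmDE mulnDl.
Qed.

(* Allows [ishomog1 d (wdeg w)], homogeneity of weighted degree d. *)
HB.instance Definition _ := mpoly.isMeasure.Build n wdeg wdeg0 wdegD.

End WeightedDegree.

Section IdealPowers.
Variable A : idomainType.

Definition ideal_mul (I J : set A) : set A :=
  [set f | exists (N : nat) (a b : 'I_N -> A),
     (forall l, I (a l)) /\ (forall l, J (b l)) /\ f = \sum_l a l * b l].

Definition ideal_pow (I : set A) (n : nat) : set A :=
  iter n (ideal_mul I) [set: A].

(* The extension of the ideal I to the localization of A at the prime P, seen
   inside the fraction field of A. *)
Definition loc_ext (P I : set A) : set {fraction A} :=
  [set x | exists a s, [/\ I a, ~ P s & x = FracField.tofrac a / FracField.tofrac s]].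

Definition symbolic_pow (P : set A) (n : nat) : set A :=
  (@FracField.tofrac A) @^-1` loc_ext P (ideal_pow P n).

Definition resurgence (R : realType) (P : set A) : \bar R :=
  ereal_sup [set x | exists n r : nat,
    [/\ (1 <= n)%N, (1 <= r)%N, ~ (symbolic_pow P n `<=` ideal_pow P r)
      & x = (n%:R / r%:R)%:E]].

End IdealPowers.

Section GradedInvariants.
Variables (k : fieldType) (n : nat) (w : 'I_n -> nat).
Local Notation T := (mpoly n k).

Definition whomog_in (I : set T) (d : nat) : Prop :=
  exists f : T, [/\ I f, f != 0 & f \is ishomog1 d (wdeg w)].

(* The value is 0 if I has no nonzero homogeneous element. *)
Definition alpha (I : set T) : nat :=
  xget 0%N [set d | whomog_in I d /\ forall e, whomog_in I e -> (d <= e)%N].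

Definition waldschmidt (R : realType) (P : set T) : R :=
  lim ((fun s : nat => (alpha (symbolic_pow P s))%:R / s%:R : R) @ \oo).

(* A complex  ... -> F_1 -> F_0 -> T  of graded free modules of finite rank,
   F_i being the direct sum of the T(- fshift i j), j < frank i.  Elements of
   F_i are row vectors, and maps act by right multiplication by a matrix. *)
Record free_cpx := FreeCpx {
  frank : nat -> nat;
  fshift : forall i, 'I_(frank i) -> int;
  faug : 'cV[T]_(frank 0);
  fdiff : forall i, 'M[T]_(frank i.+1, frank i) }.

Definition degree_preserving (F : free_cpx) : Prop :=
  (forall j, {in msupp (faug F j 0),
     forall mon, (wdeg w mon)%:Z = fshift j}) /\
  (forall i j l, {in msupp (fdiff F i j l),
     forall mon, (wdeg w mon)%:Z = fshift j - fshift l}).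

Definition resolves (F : free_cpx) (I : set T) : Prop :=
  [/\ forall f, I f <-> exists v : 'rV_(frank F 0), f = (v *m faug F) 0 0,
      forall v : 'rV_(frank F 0),
        v *m faug F = 0 <-> exists u, v = u *m fdiff F 0
    & forall i (v : 'rV_(frank F i.+1)),
        v *m fdiff F i = 0 <-> exists u, v = u *m fdiff F i.+1].

(* d(F_{i+1}) lies in (x_1, ..., x_n) F_i. *)
Definition minimal_cpx (F : free_cpx) : Prop :=
  forall i j l, mcoeff (@mnm0 n) (fdiff F i j l) = 0.

Definition min_graded_free_res (I : set T) (F : free_cpx) : Prop :=
  [/\ degree_preserving F, resolves F I & minimal_cpx F].

(* Minimal graded free resolutions of I are isomorphic to one another, hence
   share their shifts, so the supremum over all of them is the maximum over
   any one of them. *)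
Definition regularity (R : realType) (I : set T) : \bar R :=
  ereal_sup [set x | exists (F : free_cpx) (i : nat) (j : 'I_(frank F i)),
    min_graded_free_res I F /\ x = ((fshift j - i%:Z)%:~R)%:E].

End GradedInvariants.

Section MonomialCurve.
Variables (k : fieldType) (m : nat).

Definition curve_wt (i : 'I_3) : nat := (3 + i * m)%N.

Definition curve_map : mpoly 3 k -> {poly k} :=
  mmap polyC (fun i => 'X^(curve_wt i)).

Definition curve_ideal : set (mpoly 3 k) := [set f | curve_map f = 0].

End MonomialCurve.

Arguments curve_ideal : clear implicits.

(* Main.v *)
From HB Require Import structures.
Require Import Defs.
From mathcomp Require Import all_boot all_order all_algebra.
From mathcomp Require Import -(notations) mpoly.
From mathcomp Require Import all_classical all_reals all_analysis.
From mathcomp Require Import ring zify.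

Set Implicit Arguments.
Unset Strict Implicit.
Unset Printing Implicit Defensive.

Import Order.TTheory GRing.Theory Num.Theory numFieldNormedType.Exports.

Local Open Scope ring_scope.

(* Let f1 = x2^2 - x1 x3, f2 = x2 x3 - x1^2 y, f3 = x3^2 - x1 x2 y with y = x1^m be
   the minors generating p, and Delta the element with x1 Delta = f2^2 - f1 f3.
   T is free over k[x1, f1, Delta] with basis 1, x2, x3, f2, f3, x2 f3: for the
   weights (0, 2, 3) the products of these elements have distinct leading
   monomials.  Giving f1, f2, f3 order 1 and Delta order 2 yields a filtration of
   T which absorbs multiplication by T and goes up one step under p.  An element
   outside p divides, modulo p, a nonzero polynomial in x1, and multiplication by
   such a polynomial does not change orders; hence p^(n) lies in the n-th step.
   As Delta^2 lies in p^3, the n-th step lies in p^r as soon as 4 r < 3 n, so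
   rho(p) <= 4/3.  On the other side, f1^n lies in p^(n), so gamma(p) <= 6 + 2 m,
   the Hilbert-Burch resolution gives reg(p) >= 8 + 5 m, and
   4/3 <= (8 + 5 m) / (6 + 2 m). *)

(** * Polynomials without monomials in a given set *)

Section VanishingCoefficients.
Variables (k : fieldType) (n : nat).
Local Notation T := (mpoly n k).
Implicit Types (P : pred (multinom n)) (f g : T).

Definition vanish P f := forall a, P a -> mcoeff a f = 0.

Lemma vanishD P f g : vanish P f -> vanish P g -> vanish P (f + g).
Proof. by move=> Hf Hg a Pa; rewrite mcoeffD Hf // Hg // addr0. Qed.

Lemma vanishN P f : vanish P f -> vanish P (- f).
Proof. by move=> Hf a Pa; rewrite mcoeffN Hf // oppr0. Qed.

Lemma vanishZ P c f : vanish P f -> vanish P (c *: f).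
Proof. by move=> Hf a Pa; rewrite mcoeffZ Hf // mulr0. Qed.

Lemma vanish_sub P (Q : pred (multinom n)) f :
  (forall a, Q a -> P a) -> vanish P f -> vanish Q f.
Proof. by move=> QP Hf a /QP /Hf. Qed.

Lemma vanishP P f : vanish P f <-> (forall a, a \in msupp f -> ~~ P a).
Proof.
split=> H a; last by move=> Pa; apply/eqP; rewrite mcoeff_eq0; apply: contraL Pa => /H.
by rewrite mcoeff_msupp; apply: contraNN => /H ->.
Qed.

Lemma vanishX P a : ~~ P a -> vanish P (mpolyX k a).
Proof. by move=> Pa; apply/vanishP => b; rewrite msuppX inE => /eqP ->. Qed.

Lemma vanish_sum P (I : Type) (r : seq I) (Q : pred I) (F : I -> T) :
  (forall i, Q i -> vanish P (F i)) -> vanish P (\sum_(i <- r | Q i) F i).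
Proof.
move=> H; elim/big_rec: _ => [a _|i x Qi Hx]; first by rewrite mcoeff0.
by apply: vanishD => //; apply: H.
Qed.

Lemma vanish_split P f :
  exists g h, [/\ f = g + h, vanish P g & vanish (predC P) h].
Proof.
exists (\sum_(a <- msupp f | ~~ P a) mcoeff a f *: mpolyX k a).
exists (\sum_(a <- msupp f | P a) mcoeff a f *: mpolyX k a); split.
- by rewrite {1}[f]mpolyE (bigID P) addrC.
- by apply: vanish_sum => a Pa; apply/vanishZ/vanishX.
- by apply: vanish_sum => a Pa; apply/vanishZ/vanishX; rewrite /= Pa.
Qed.

Lemma vanish_disjoint P f : vanish P f -> vanish (predC P) f -> f = 0.
Proof.
move=> Hf Hf'; apply/mpolyP => a; rewrite mcoeff0.
by case: (boolP (P a)) => [/Hf|/Hf'].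
Qed.

Lemma vanish_dvd a f : vanish (fun b => ~~ mpoly.lem a b) f ->
  exists g, f = mpolyX k a * g.
Proof.
move/vanishP=> H.
exists (\sum_(b <- msupp f) mcoeff b f *: mpolyX k (mnm_sub b a)).
rewrite {1}[f]mpolyE mulr_sumr !big_seq; apply: eq_bigr => b /H.
by rewrite negbK -scalerAr -mpolyXD => ab; rewrite addmC submK.
Qed.

Lemma vanish_XM a f : vanish (fun b => ~~ mpoly.lem a b) (mpolyX k a * f).
Proof.
apply/vanishP => b; rewrite mulrC (perm_mem (msuppMX _ _)) negbK.
by case/mapP => c _ ->; rewrite lem_addr.
Qed.

End VanishingCoefficients.

(** * Linear endomorphisms prescribed on the monomial basis *)

Section MonomialExtension.
Variables (k : fieldType) (n : nat) (g : multinom n -> mpoly n k).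
Local Notation T := (mpoly n k).

Definition mon_ext (f : T) : T := \sum_(a <- msupp f) mcoeff a f *: g a.

(** Any list without repetition that contains the support can index the sum, so polynomials with
    different supports are expanded over a common list. *)
Lemma mon_extE (s : seq (multinom n)) f : uniq s -> {subset msupp f <= s} ->
  mon_ext f = \sum_(a <- s) mcoeff a f *: g a.
Proof.
move=> us sub; rewrite (bigID (mem (msupp f))) /= [X in _ + X]big1 => [|a]; last first.
  by rewrite -mcoeff_eq0 => /eqP ->; rewrite scale0r.
rewrite addr0 -[RHS]big_filter; apply: perm_big; apply: uniq_perm.
- exact: msupp_uniq.
- by rewrite filter_uniq.
- by move=> a; rewrite mem_filter andb_idr //; apply: sub.
Qed.

Fact mon_ext_linear : linear mon_ext.
Proof.
move=> c f h; set s := undup (msupp f ++ msupp h ++ msupp (c *: f + h)).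
have us : uniq s by exact: undup_uniq.
rewrite !(@mon_extE s) //; first last.
- by move=> a ha; rewrite mem_undup !mem_cat ha ?orbT.
- by move=> a ha; rewrite mem_undup !mem_cat ha ?orbT.
- by move=> a ha; rewrite mem_undup !mem_cat ha ?orbT.
rewrite scaler_sumr -big_split; apply: eq_bigr => a _ /=.
by rewrite mcoeffD mcoeffZ scalerDl scalerA.
Qed.

HB.instance Definition _ :=
  GRing.isLinear.Build k T T *:%R mon_ext mon_ext_linear.

Lemma mon_extD f h : mon_ext (f + h) = mon_ext f + mon_ext h.
Proof. exact: raddfD. Qed.

Lemma mon_ext0 : mon_ext 0 = 0.
Proof. exact: raddf0. Qed.

Lemma mon_extB f h : mon_ext (f - h) = mon_ext f - mon_ext h.
Proof. exact: raddfB. Qed.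

Lemma mon_extZ c f : mon_ext (c *: f) = c *: mon_ext f.
Proof. by rewrite -[c *: f]addr0 mon_ext_linear raddf0 addr0. Qed.

Lemma mon_extX a : mon_ext (mpolyX k a) = g a.
Proof. by rewrite /mon_ext msuppX big_seq1 mcoeffX eqxx scale1r. Qed.

Lemma mon_extM a h : (forall b, g (mnm_add a b) = h * g b) ->
  forall f, mon_ext (mpolyX k a * f) = h * mon_ext f.
Proof.
move=> H f; rewrite {1}[f]mpolyE mulr_sumr raddf_sum /= [in RHS]/mon_ext mulr_sumr.
apply: eq_bigr => b _.
by rewrite -mul_mpolyC mulrCA -mpolyXD mul_mpolyC mon_extZ mon_extX H -!mul_mpolyC mulrCA.
Qed.

Variable w : 'I_n -> nat.
Local Notation wt := (wdeg w).

(** The weak inequality covers [a] itself and all ties: [a] has coefficient 1 in [h], and every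
    other monomial of [h] has strictly smaller weight. *)
Definition leads (h : T) a := vanish (fun b => (wt a <= wt b)%N) (h - mpolyX k a).

Hypothesis gP : forall a, leads (g a) a.

(** A monomial of maximal weight in [f] keeps its coefficient in [mon_ext f], since the images of
    the other monomials of [f] cannot contain it. *)
Lemma mon_ext_inj f : mon_ext f = 0 -> f = 0.
Proof.
move=> f0; apply/eqP; rewrite -msupp_eq0; apply: contraTT isT => nz.
have : exists2 a, a \in msupp f & forall b, b \in msupp f -> (wt b <= wt a)%N.
  elim: (msupp f) nz => // a [|c s] IH _.
    by exists a; rewrite ?inE // => b; rewrite inE => /eqP ->.
  case: (IH isT) => b bs Hb.
  case: (leqP (wt a) (wt b)) => ab.
    exists b; first by rewrite inE bs orbT.
    by move=> d; rewrite inE => /predU1P [->//|/Hb].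
  exists a; first by rewrite inE eqxx.
  move=> d; rewrite inE => /predU1P [->//|/Hb db].
  exact: leq_trans db (ltnW ab).
case=> a af amax.
have: mcoeff a (mon_ext f) = mcoeff a f.
  rewrite /mon_ext raddf_sum (bigD1_seq a) ?msupp_uniq //= big_seq_cond big1.
    rewrite mcoeffZ -[g a](subrK (mpolyX k a)) mcoeffD gP // mcoeffX eqxx.
    by rewrite add0r mulr1 addr0.
  move=> b /andP[/amax bf ba].
  rewrite mcoeffZ -[g b](subrK (mpolyX k b)) mcoeffD gP // mcoeffX (negPf ba).
  by rewrite addr0 mulr0.
by rewrite f0 mcoeff0 => /esym /eqP; rewrite mcoeff_eq0 af.
Qed.

End MonomialExtension.

(** * Leading monomials of products and powers *)

Section LeadingMonomials.
Variables (k : fieldType) (n : nat) (w : 'I_n -> nat).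
Local Notation T := (mpoly n k).
Local Notation wt := (wdeg w).

Definition wlt W (h : T) := vanish (fun b => (W <= wt b)%N) h.

Lemma wltX a : wlt (wt a).+1 (mpolyX k a).
Proof. by apply: vanishX; rewrite -ltnNge. Qed.

Lemma wltW W V h : (W <= V)%N -> wlt W h -> wlt V h.
Proof. by move=> WV; apply: vanish_sub => a; apply: leq_trans. Qed.

(** Weights below [W] and at most [V] add up to less than [W + V]. The bound [V.+1] admits a factor
    of weight exactly [V], such as a leading monomial. *)
Lemma wltM W V g h : wlt W g -> wlt V.+1 h -> wlt (W + V) (g * h).
Proof.
move=> /vanishP Hg /vanishP Hh; apply/vanishP => a /msuppM_le /allpairsP.
case=> -[b c] /= [/Hg + /Hh + ->]; rewrite wdegD; lia.
Qed.

Lemma leads_wlt (g : T) a : leads w g a -> wlt (wt a).+1 g.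
Proof.
move=> H; rewrite -[g](subrK (mpolyX k a)); apply: vanishD; last exact: wltX.
exact: wltW H.
Qed.

Lemma leadsX a : leads w (mpolyX k a) a.
Proof. by move=> b _; rewrite subrr mcoeff0. Qed.

Lemma leadsM (g h : T) a b : leads w g a -> leads w h b -> leads w (g * h) (mnm_add a b).
Proof.
move=> Hg Hh; have Hg1 : wlt (wt a) (g - mpolyX k a) by exact: Hg.
have Hh1 : wlt (wt b) (h - mpolyX k b) by exact: Hh.
suff H : wlt (wt a + wt b) (g * h - mpolyX k (mnm_add a b)).
  by move=> c; rewrite wdegD; apply: H.
rewrite mpolyXD (_ : g * h - mpolyX k a * mpolyX k b =
  (g - mpolyX k a) * h + (h - mpolyX k b) * mpolyX k a); last by ring.
apply: vanishD; first exact: wltM Hg1 (leads_wlt Hh).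
by have := wltM Hh1 (@wltX a); rewrite addnC.
Qed.

Lemma leads1 : leads w (1 : T) (@mnm0 n).
Proof. by rewrite -mpolyX0; apply: leadsX. Qed.

Lemma leads_exp (g : T) a i : leads w g a -> leads w (g ^+ i) (mnm_muln a i).
Proof.
move=> H; elim: i => [|i IH]; first by rewrite expr0 mulm0n; apply: leads1.
by rewrite exprS mulmS; apply: leadsM.
Qed.

End LeadingMonomials.

(** * The minors, Delta, and the basis of T adapted to them *)

Definition i1 : 'I_3 := ord0.
Definition i2 : 'I_3 := Ordinal (isT : (1 < 3)%N).
Definition i3 : 'I_3 := Ordinal (isT : (2 < 3)%N).

Section CurveEquations.
Variables (k : fieldType) (m : nat).
Local Notation T := (mpoly 3 k).
Local Notation x1 := (mpolyX k (mnm1 i1)).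
Local Notation x2 := (mpolyX k (mnm1 i2)).
Local Notation x3 := (mpolyX k (mnm1 i3)).
Local Notation y := (x1 ^+ m).

Definition f1 : T := x2 ^+ 2 - x1 * x3.
Definition f2 : T := x2 * x3 - x1 ^+ 2 * y.
Definition f3 : T := x3 ^+ 2 - x1 * y * x2.
(** This is X^3 + Y^3 + Z^3 - 3 X Y Z, a circulant determinant, at X = x3, Y = y^(1/3) x2, Z =
    y^(2/3) x1. It lies in the second symbolic power, as x1 Delta lies in p^2 and x1 is outside
    p. *)
Definition Delta : T :=
  x3 ^+ 3 - 3%:R * (x1 * y * x2 * x3) + x1 ^+ 3 * y ^+ 2 + y * x2 ^+ 3.
Local Notation D := Delta.

Lemma DeltaE : D = x3 * f3 - x1 * y * f2 + y * x2 * f1.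
Proof. rewrite /D /f1 /f2 /f3; ring. Qed.

Lemma mulx1D : x1 * D = f2 ^+ 2 - f1 * f3.
Proof. rewrite /D /f1 /f2 /f3; ring. Qed.

(** For [e < 2] and [d < 3] the leading monomial is x2^e x3^d; f2 and f3 replace x2 x3 and x3^2 so
    that the basis displays the elements of p. *)
Definition fbasis (e d : nat) : T :=
  match e, d with
  | 0%N, 0%N => 1 | 0%N, 1%N => x3 | 0%N, _ => f3
  | _, 0%N => x2 | _, 1%N => f2 | _, _ => x2 * f3
  end.

Definition gmon (a : multinom 3) : T :=
  x1 ^+ a i1 * f1 ^+ (a i2 %/ 2) * D ^+ (a i3 %/ 3) * fbasis (a i2 %% 2) (a i3 %% 3).

(* For the weights (0, 2, 3) the leading monomials of f1, f2, f3, Delta are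
   x2^2, x2 x3, x3^2, x3^3, so the leading monomial of gmon a is a. *)
Definition leadw (i : 'I_3) : nat := if i == i1 then 0 else i.+1.

Definition mon3 (a u v : nat) : multinom 3 :=
  mnm_add (mnm_add (mnm_muln (mnm1 i1) a) (mnm_muln (mnm1 i2) u)) (mnm_muln (mnm1 i3) v).

Lemma mon3E a u v : (mon3 a u v i1 = a) * (mon3 a u v i2 = u) * (mon3 a u v i3 = v).
Proof. by rewrite /mon3 !mnmDE !mulmnE !mnm1E /=; split; [split|]; lia. Qed.

Lemma mnm3P (a b : multinom 3) :
  a i1 = b i1 -> a i2 = b i2 -> a i3 = b i3 -> a = b.
Proof.
move=> h1 h2 h3; apply/mnmP => -[[|[|[|//]]] h].
- by rewrite (_ : Ordinal h = i1) //; apply: val_inj.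
- by rewrite (_ : Ordinal h = i2) //; apply: val_inj.
- by rewrite (_ : Ordinal h = i3) //; apply: val_inj.
Qed.

Lemma mon3K (a : multinom 3) : mon3 (a i1) (a i2) (a i3) = a.
Proof. by apply: mnm3P; rewrite mon3E. Qed.

Lemma mpolyX_mon3 (a u v : nat) : mpolyX k (mon3 a u v) = x1 ^+ a * x2 ^+ u * x3 ^+ v.
Proof. by rewrite /mon3 !mpolyXD !mpolyXn. Qed.

Lemma wdeg3 (w : 'I_3 -> nat) a : wdeg w a = (a i1 * w i1 + a i2 * w i2 + a i3 * w i3)%N.
Proof.
rewrite /wdeg !big_ord_recl big_ord0 addn0 addnA.
by congr (_ * w _ + _ * w _ + _ * w _)%N; try congr (a _); apply: val_inj.
Qed.

Lemma wdeg_leadw a : wdeg leadw a = (2 * a i2 + 3 * a i3)%N.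
Proof.
rewrite wdeg3 (_ : leadw i1 = 0%N) // (_ : leadw i2 = 2%N) // (_ : leadw i3 = 3%N) //; lia.
Qed.

Lemma wlt_mon a u v W : (2 * u + 3 * v < W)%N -> wlt leadw W (x1 ^+ a * x2 ^+ u * x3 ^+ v).
Proof.
move=> H; rewrite -mpolyX_mon3; apply: wltW (@wltX _ _ _ _).
by rewrite wdeg_leadw !mon3E; lia.
Qed.

Lemma leads_f1 : leads leadw f1 (mnm_muln (mnm1 i2) 2).
Proof.
rewrite /leads -mpolyXn (_ : f1 - _ = - (x1 ^+ 1 * x2 ^+ 0 * x3 ^+ 1));
  last by rewrite /f1; ring.
by apply: vanishN; apply: wlt_mon; rewrite wdeg_leadw !mulmnE !mnm1E.
Qed.

Lemma leads_f2 : leads leadw f2 (mnm_add (mnm1 i2) (mnm1 i3)).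
Proof.
rewrite /leads mpolyXD (_ : f2 - _ = - (x1 ^+ (2 + m) * x2 ^+ 0 * x3 ^+ 0));
  last by rewrite /f2 exprD; ring.
by apply: vanishN; apply: wlt_mon; rewrite wdeg_leadw !mnmDE !mnm1E.
Qed.

Lemma leads_f3 : leads leadw f3 (mnm_muln (mnm1 i3) 2).
Proof.
rewrite /leads -mpolyXn (_ : f3 - _ = - (x1 ^+ m.+1 * x2 ^+ 1 * x3 ^+ 0));
  last by rewrite /f3 (exprS _ m); ring.
by apply: vanishN; apply: wlt_mon; rewrite wdeg_leadw !mulmnE !mnm1E.
Qed.

Lemma leads_Delta : leads leadw D (mnm_muln (mnm1 i3) 3).
Proof.
rewrite /leads -mpolyXn (_ : D - _ =
  x1 ^+ (m * 2 + 3) * x2 ^+ 0 * x3 ^+ 0 + x1 ^+ m * x2 ^+ 3 * x3 ^+ 0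
  - 3%:R *: (x1 ^+ m.+1 * x2 ^+ 1 * x3 ^+ 1)); last first.
  by rewrite -mul_mpolyC rmorph_nat /D !exprD exprM (exprS _ m); ring.
by apply: vanishD; [apply: vanishD | apply/vanishN/vanishZ];
  apply: wlt_mon; rewrite wdeg_leadw !mulmnE !mnm1E.
Qed.

Lemma leads_gmon a : leads leadw (gmon a) a.
Proof.
have He : leads leadw (fbasis (a i2 %% 2) (a i3 %% 3)) (mon3 0 (a i2 %% 2) (a i3 %% 3)).
  have := ltn_pmod (a i2) (isT : 0 < 2)%N; have := ltn_pmod (a i3) (isT : 0 < 3)%N.
  case: (a i2 %% 2)%N (a i3 %% 3)%N => [|[|//]] [|[|[|//]]] _ _ /=.
  - by rewrite (_ : mon3 0 0 0 = @mnm0 3);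
      [exact: leads1|apply: mnm3P; rewrite mon3E mnm0E].
  - by rewrite (_ : mon3 0 0 1 = mnm1 i3);
      [exact: leadsX|apply: mnm3P; rewrite mon3E mnm1E].
  - by rewrite (_ : mon3 0 0 2 = mnm_muln (mnm1 i3) 2);
      [exact: leads_f3|apply: mnm3P; rewrite mon3E mulmnE mnm1E].
  - by rewrite (_ : mon3 0 1 0 = mnm1 i2);
      [exact: leadsX|apply: mnm3P; rewrite mon3E mnm1E].
  - by rewrite (_ : mon3 0 1 1 = mnm_add (mnm1 i2) (mnm1 i3));
      [exact: leads_f2|apply: mnm3P; rewrite mon3E mnmDE !mnm1E].
  - rewrite (_ : mon3 0 1 2 = mnm_add (mnm1 i2) (mnm_muln (mnm1 i3) 2)); last first.
      by apply: mnm3P; rewrite mon3E mnmDE mulmnE !mnm1E.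
    by apply: leadsM; [exact: leadsX|exact: leads_f3].
have H1 := @leads_exp k _ leadw _ _ (a i1) (@leadsX _ _ leadw (mnm1 i1)).
have H2 := @leads_exp _ _ _ _ _ (a i2 %/ 2) leads_f1.
have H3 := @leads_exp _ _ _ _ _ (a i3 %/ 3) leads_Delta.
have := leadsM (leadsM (leadsM H1 H2) H3) He.
rewrite (_ : mnm_add _ _ = a) //; apply: mnm3P.
- by rewrite !mnmDE !mulmnE !mnm1E ?mon3E /=; lia.
- by rewrite !mnmDE !mulmnE !mnm1E ?mon3E /=; lia.
- by rewrite !mnmDE !mulmnE !mnm1E ?mon3E /=; lia.
Qed.

(** A change of coordinates, linear over k[x1], under which x2^2 and x3^3 act as f1 and Delta.
    Injectivity comes from the leading monomials, surjectivity from [filtT]. *)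
Definition theta : T -> T := mon_ext gmon.

Lemma theta_inj f h : theta f = theta h -> f = h.
Proof.
move=> fh; apply/eqP; rewrite -subr_eq0; apply/eqP/(mon_ext_inj leads_gmon).
by rewrite mon_extB -/theta fh subrr.
Qed.

Lemma theta_x1 f : theta (x1 * f) = x1 * theta f.
Proof.
apply: mon_extM => a; rewrite /gmon !mnmDE !mnm1E /= !add0n exprS.
by rewrite -!mulrA.
Qed.

Lemma theta_x22 f : theta (x2 ^+ 2 * f) = f1 * theta f.
Proof.
rewrite mpolyXn; apply: mon_extM => a; rewrite /gmon.
have -> : mnm_add (mnm_muln (mnm1 i2) 2) a i1 = a i1 by rewrite mnmDE mulmnE mnm1E.
have -> : mnm_add (mnm_muln (mnm1 i2) 2) a i3 = a i3 by rewrite mnmDE mulmnE mnm1E.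
have -> : mnm_add (mnm_muln (mnm1 i2) 2) a i2 = (2 + a i2)%N.
  by rewrite mnmDE mulmnE mnm1E.
rewrite modnDl (_ : (2 + a i2) %/ 2 = (a i2 %/ 2).+1)%N; last by lia.
by rewrite exprS; ring.
Qed.

Lemma theta_x33 f : theta (x3 ^+ 3 * f) = D * theta f.
Proof.
rewrite mpolyXn; apply: mon_extM => a; rewrite /gmon.
have -> : mnm_add (mnm_muln (mnm1 i3) 3) a i1 = a i1 by rewrite mnmDE mulmnE mnm1E.
have -> : mnm_add (mnm_muln (mnm1 i3) 3) a i2 = a i2 by rewrite mnmDE mulmnE mnm1E.
have -> : mnm_add (mnm_muln (mnm1 i3) 3) a i3 = (3 + a i3)%N.
  by rewrite mnmDE mulmnE mnm1E.
rewrite modnDl (_ : (3 + a i3) %/ 3 = (a i3 %/ 3).+1)%N; last by lia.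
by rewrite exprS; ring.
Qed.

End CurveEquations.

(** * The filtration of T by order *)

Section Filtration.
Variables (k : fieldType) (m : nat).
Local Notation T := (mpoly 3 k).
Local Notation x1 := (mpolyX k (mnm1 i1)).
Local Notation x2 := (mpolyX k (mnm1 i2)).
Local Notation x3 := (mpolyX k (mnm1 i3)).
Local Notation y := (x1 ^+ m).
Local Notation f1 := (f1 k).
Local Notation f2 := (f2 k m).
Local Notation f3 := (f3 k m).
Local Notation D := (Delta k m).
Local Notation fbasis := (fbasis k m).
Local Notation theta := (theta m).

(* The order of [gmon a], where f1, f2, f3 count for 1 and Delta for 2. *)
Definition gord (a : multinom 3) : nat :=
  a i2 %/ 2 + 2 * (a i3 %/ 3) + (a i2 %% 2 + a i3 %% 3) %/ 2.

(** As [theta] is injective, [b] is unique, and membership is a condition on the coordinates of [h]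
    in the basis [gmon]. *)
Definition filt (n : nat) (h : T) : Prop :=
  exists2 b, vanish (fun a => gord a < n)%N b & h = theta b.

Lemma filtD n f h : filt n f -> filt n h -> filt n (f + h).
Proof.
case=> b Hb -> [c Hc ->]; exists (b + c); first exact: vanishD.
by rewrite /theta mon_extD.
Qed.

Lemma filtZ n c f : filt n f -> filt n (c *: f).
Proof.
by case=> b Hb ->; exists (c *: b); [exact: vanishZ|rewrite /theta mon_extZ].
Qed.

Lemma filtN n f : filt n f -> filt n (- f).
Proof. by move=> H; rewrite -scaleN1r; apply: filtZ. Qed.

Lemma filtB n f h : filt n f -> filt n h -> filt n (f - h).
Proof. by move=> Hf Hh; apply: filtD => //; apply: filtN. Qed.

Lemma filt0 n : filt n 0.
Proof.
by exists 0; [move=> a _; rewrite mcoeff0|rewrite /theta mon_ext0].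
Qed.

Lemma filt_sum n (I : Type) (r : seq I) (F : I -> T) :
  (forall i, filt n (F i)) -> filt n (\sum_(i <- r) F i).
Proof.
by move=> H; elim/big_ind: _ => //; [exact: filt0|exact: filtD].
Qed.

Lemma filt_le n l f : (l <= n)%N -> filt n f -> filt l f.
Proof.
move=> ln [b Hb ->]; exists b => //; apply: vanish_sub Hb => a; lia.
Qed.

Lemma filt_gmon n a : (n <= gord a)%N -> filt n (gmon k m a).
Proof.
move=> H; exists (mpolyX k a); first by apply: vanishX; rewrite -leqNgt.
by rewrite /theta mon_extX.
Qed.

Lemma vanish_gordXM a b d n : (forall c, gord (mnm_add a c) = gord c + d)%N ->
  vanish (fun c => gord c < n)%N b -> vanish (fun c => gord c < n + d)%N (mpolyX k a * b).
Proof.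
move=> H /vanishP Hb; apply/vanishP => c; rewrite mulrC (perm_mem (msuppMX _ _)).
by case/mapP => e /Hb He ->; rewrite H; lia.
Qed.

Lemma gord_x1 c : gord (mnm_add (mnm1 i1) c) = (gord c + 0)%N.
Proof. by rewrite /gord !mnmDE !mnm1E addn0. Qed.

Lemma filt_x1 n f : filt n f -> filt n (x1 * f).
Proof.
case=> b Hb ->; exists (x1 * b); last by rewrite -theta_x1.
by rewrite -[n]addn0; apply: vanish_gordXM Hb; apply: gord_x1.
Qed.

(** Multiplication by x2^2 raises [gord] by 1 and corresponds to f1 under [theta]. The truncated
    predecessor lets the lemma apply backwards to a goal of any order, 0 included. *)
Lemma filt_f1 n f : filt n.-1 f -> filt n (f1 * f).
Proof.
case=> b Hb ->; apply: (@filt_le (n.-1 + 1)); first by lia.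
exists (x2 ^+ 2 * b); last by rewrite theta_x22.
rewrite mpolyXn; apply: vanish_gordXM Hb => c.
by rewrite /gord !mnmDE ?mulmnE !mnm1E /=; lia.
Qed.

Lemma filt_Delta n f : filt n.-2 f -> filt n (D * f).
Proof.
case=> b Hb ->; apply: (@filt_le (n.-2 + 2)); first by lia.
exists (x3 ^+ 3 * b); last by rewrite theta_x33.
rewrite mpolyXn; apply: vanish_gordXM Hb => c.
by rewrite /gord !mnmDE ?mulmnE !mnm1E /=; lia.
Qed.

Lemma filt_x1n n i f : filt n f -> filt n (x1 ^+ i * f).
Proof.
by move=> H; elim: i => [|i IH]; rewrite ?mul1r // exprS -mulrA; apply: filt_x1.
Qed.

Lemma filt_f1n n i f : filt n f -> filt (n + i) (f1 ^+ i * f).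
Proof.
move=> H; elim: i => [|i IH]; first by rewrite addn0 mul1r.
by rewrite exprS -mulrA; apply: filt_f1; rewrite addnS.
Qed.

Lemma filt_Deltan n i f : filt n f -> filt (n + 2 * i) (D ^+ i * f).
Proof.
move=> H; elim: i => [|i IH]; first by rewrite addn0 mul1r.
by rewrite exprS -mulrA; apply: filt_Delta; rewrite mulnS addnCA.
Qed.

Definition bord (e d : nat) : nat := (e + d) %/ 2.

Lemma filt_fbasis e d : (e < 2)%N -> (d < 3)%N -> filt (bord e d) (fbasis e d).
Proof.
move=> he hd; have := @filt_gmon (bord e d) (mon3 0 e d).
rewrite /gord /gmon !mon3E divn_small // divn_small // !modn_small // !mul1r.
exact.
Qed.

(** The factors x1, f1 and Delta have a known effect on orders and can be moved out, so six products
    with basis elements decide how multiplication by [h] acts; [s] is the gain in order. *)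
Lemma filt_mul h s : (forall e d, (e < 2)%N -> (d < 3)%N -> filt (bord e d + s) (h * fbasis e d)) ->
  forall n f, filt n f -> filt (n + s) (h * f).
Proof.
move=> H n _ [b /vanishP Hb ->].
rewrite /theta /mon_ext mulr_sumr big_seq.
elim/big_ind: _ => [||a /Hb ab]; [exact: filt0|exact: filtD|].
rewrite -mul_mpolyC mulrCA mul_mpolyC; apply: filtZ.
have he : (a i2 %% 2 < 2)%N by rewrite ltn_mod.
have hd : (a i3 %% 3 < 3)%N by rewrite ltn_mod.
rewrite /gmon mulrCA -!mulrA.
apply: filt_le (filt_x1n _ (filt_f1n (a i2 %/ 2) (filt_Deltan (a i3 %/ 3) (H _ _ he hd)))).
by move: ab; rewrite -leqNgt /gord /bord; lia.
Qed.

Lemma filt_b0 : filt 0 1. Proof. exact: (@filt_fbasis 0 0). Qed.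
Lemma filt_b3 : filt 0 x3. Proof. exact: (@filt_fbasis 0 1). Qed.
Lemma filt_bf3 : filt 1 f3. Proof. exact: (@filt_fbasis 0 2). Qed.
Lemma filt_b2 : filt 0 x2. Proof. exact: (@filt_fbasis 1 0). Qed.
Lemma filt_bf2 : filt 1 f2. Proof. exact: (@filt_fbasis 1 1). Qed.
Lemma filt_bx2f3 : filt 1 (x2 * f3). Proof. exact: (@filt_fbasis 1 2). Qed.

Local Ltac filt_leaf := first
  [ by apply: (filt_le _ filt_b0) | by apply: (filt_le _ filt_b2) | by apply: (filt_le _ filt_b3)
  | by apply: (filt_le _ filt_bf2) | by apply: (filt_le _ filt_bf3)
  | by apply: (filt_le _ filt_bx2f3) ].

Local Ltac filt_terms := repeat first
  [ filt_leaf | apply: filtB | apply: filtD | apply: filt_f1 | apply: filt_Delta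
  | apply: filt_x1 | apply: filt_x1n ].

(* The rewritings below, up to [filt_f3], are the multiplication table of T over
   k[x1, f1, Delta] in the basis [fbasis]. *)
Lemma filt_x2 n f : filt n f -> filt n (x2 * f).
Proof.
rewrite -{2}[n]addn0; apply: filt_mul => -[|[|//]] [|[|[|//]]] _ _ /=; rewrite /bord /=.
- rewrite mulr1; filt_terms.
- rewrite (_ : _ * _ = f2 + x1 * (x1 * (y * 1))); last by rewrite /f2; ring.
  filt_terms.
- filt_terms.
- rewrite (_ : _ * _ = x1 * x3 + f1 * 1); last by rewrite /f1; ring.
  filt_terms.
- rewrite (_ : _ * _ = x1 * f3 + f1 * x3); last by rewrite /f1 /f2 /f3; ring.
  filt_terms.
- rewrite (_ : _ * _ = x1 * (D * 1) + x1 * (x1 * (y * f2)) - x1 * (y * (f1 * x2)) + f1 * f3);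
    last by rewrite /D /f1 /f2 /f3; ring.
  filt_terms.
Qed.

Lemma filt_x3 n f : filt n f -> filt n (x3 * f).
Proof.
rewrite -{2}[n]addn0; apply: filt_mul => -[|[|//]] [|[|[|//]]] _ _ /=; rewrite /bord /=.
- rewrite mulr1; filt_terms.
- rewrite (_ : _ * _ = f3 + x1 * (y * x2)); last by rewrite /f3; ring.
  filt_terms.
- rewrite (_ : _ * _ = D * 1 + x1 * (y * f2) - y * (f1 * x2));
    last by rewrite /D /f1 /f2 /f3; ring.
  filt_terms.
- rewrite (_ : _ * _ = f2 + x1 * (x1 * (y * 1))); last by rewrite /f2; ring.
  filt_terms.
- rewrite (_ : _ * _ = x2 * f3 + x1 * (y * (f1 * 1))); last by rewrite /f1 /f2 /f3; ring.
  filt_terms.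
- rewrite (_ : _ * _ = D * x2 - y * (f1 * (f1 * 1)) + x1 * (x1 * (y * f3)));
    last by rewrite /D /f1 /f2 /f3; ring.
  filt_terms.
Qed.

Lemma filt_f2 n f : filt n f -> filt (n + 1) (f2 * f).
Proof.
apply: filt_mul => -[|[|//]] [|[|[|//]]] _ _ /=; rewrite /bord /=.
- rewrite mulr1; filt_terms.
- rewrite (_ : _ * _ = x2 * f3 + x1 * (y * (f1 * 1))); last by rewrite /f1 /f2 /f3; ring.
  filt_terms.
- rewrite (_ : _ * _ = D * x2 - y * (f1 * (f1 * 1)));
    last by rewrite /D /f1 /f2 /f3; ring.
  filt_terms.
- rewrite (_ : _ * _ = x1 * f3 + f1 * x3); last by rewrite /f1 /f2 /f3; ring.
  filt_terms.
- rewrite (_ : _ * _ = x1 * (D * 1) + f1 * f3); last by rewrite /D /f1 /f2 /f3; ring.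
  filt_terms.
- rewrite (_ : _ * _ = x1 * (D * x3) + f1 * (D * 1) - y * (f1 * (f1 * x2)));
    last by rewrite /D /f1 /f2 /f3; ring.
  filt_terms.
Qed.

Lemma filt_f3 n f : filt n f -> filt (n + 1) (f3 * f).
Proof.
apply: filt_mul => -[|[|//]] [|[|[|//]]] _ _ /=; rewrite /bord /=.
- rewrite mulr1; filt_terms.
- rewrite (_ : _ * _ = D * 1 + x1 * (y * f2) - y * (f1 * x2));
    last by rewrite /D /f1 /f2 /f3; ring.
  filt_terms.
- rewrite (_ : _ * _ = D * x3 - y * (f1 * f2)); last by rewrite /D /f1 /f2 /f3; ring.
  filt_terms.
- rewrite (_ : _ * _ = x2 * f3); last by ring.
  filt_terms.
- rewrite (_ : _ * _ = D * x2 - y * (f1 * (f1 * 1)));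
    last by rewrite /D /f1 /f2 /f3; ring.
  filt_terms.
- rewrite (_ : _ * _ = D * f2 + x1 * (x1 * (y * (D * 1))) - x1 * (y * (f1 * f3))
                       - y * (f1 * (f1 * x3)));
    last by rewrite /D /f1 /f2 /f3; ring.
  filt_terms.
Qed.

(** Stability under scalars and the three variables makes each step an ideal of T. *)
Lemma filt_mulT h n f : filt n f -> filt n (h * f).
Proof.
move=> Hf; rewrite [h]mpolyE mulr_suml; apply: filt_sum => a.
rewrite -mul_mpolyC -mulrA mul_mpolyC; apply: filtZ.
have filt_xn (x : T) i : (forall f, filt n f -> filt n (x * f)) ->
    forall f, filt n f -> filt n (x ^+ i * f).
  move=> H f' Hf'; elim: i => [|i IH]; first by rewrite mul1r.
  by rewrite exprS -mulrA; apply: H.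
rewrite -(mon3K a) mpolyX_mon3 -!mulrA; apply: filt_x1n.
by apply: (filt_xn _ _ (@filt_x2 n)); apply: (filt_xn _ _ (@filt_x3 n)).
Qed.

(** This is the surjectivity of [theta]: its image contains 1 and is stable under multiplication by
    T. *)
Lemma filtT h : filt 0 h.
Proof. by rewrite -[h]mulr1; apply/filt_mulT/filt_b0. Qed.

End Filtration.

(** * Generators of p, and the action of p on the filtration *)

Section CurveIdeal.
Variables (k : fieldType) (m : nat).
Local Notation T := (mpoly 3 k).
Local Notation x1 := (mpolyX k (mnm1 i1)).
Local Notation x2 := (mpolyX k (mnm1 i2)).
Local Notation x3 := (mpolyX k (mnm1 i3)).
Local Notation y := (x1 ^+ m).
Local Notation f1 := (f1 k).
Local Notation f2 := (f2 k m).
Local Notation f3 := (f3 k m).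
Local Notation D := (Delta k m).
Local Notation theta := (theta m).
Local Notation curve := (@curve_map k m).

Lemma curveD f h : curve (f + h) = curve f + curve h.
Proof. by rewrite /curve_map rmorphD. Qed.

Lemma curveB f h : curve (f - h) = curve f - curve h.
Proof. by rewrite /curve_map rmorphB. Qed.

Lemma curveM f h : curve (f * h) = curve f * curve h.
Proof. by rewrite /curve_map rmorphM. Qed.

Lemma curveXn f n : curve (f ^+ n) = curve f ^+ n.
Proof. by rewrite /curve_map rmorphXn. Qed.

Lemma curve1 : curve 1 = 1.
Proof. by rewrite /curve_map rmorph1. Qed.

Lemma curveZ c f : curve (c *: f) = c *: curve f.
Proof. by rewrite -mul_mpolyC curveM /curve_map mmapC mul_polyC. Qed.

Lemma curve_sum (I : Type) (r : seq I) (F : I -> T) :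
  curve (\sum_(i <- r) F i) = \sum_(i <- r) curve (F i).
Proof. by rewrite /curve_map rmorph_sum. Qed.

Lemma curve_mon a : curve (mpolyX k a) = 'X^(wdeg (curve_wt m) a).
Proof.
rewrite /curve_map mmapX /mmap1 /wdeg -prodrXr.
by apply: eq_bigr => i _; rewrite -exprM mulnC.
Qed.

Lemma curve_wdeg a :
  wdeg (curve_wt m) a = (a i1 * 3 + a i2 * (3 + m) + a i3 * (3 + 2 * m))%N.
Proof. by rewrite wdeg3 /curve_wt /= mul0n addn0 mul1n. Qed.

Lemma curve_x1 : curve x1 = 'X^3.
Proof. by rewrite curve_mon curve_wdeg !mnm1E /=; congr 'X^_; lia. Qed.

Lemma curve_x2 : curve x2 = 'X^(3 + m).
Proof. by rewrite curve_mon curve_wdeg !mnm1E /=; congr 'X^_; lia. Qed.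

Lemma curve_x3 : curve x3 = 'X^(3 + 2 * m).
Proof. by rewrite curve_mon curve_wdeg !mnm1E /=; congr 'X^_; lia. Qed.

Lemma curve_f1 : curve f1 = 0.
Proof.
rewrite /f1 curveB curveXn curveM curve_x1 curve_x2 curve_x3.
by rewrite -exprM -exprD; apply/eqP; rewrite subr_eq0; apply/eqP; congr 'X^_; lia.
Qed.

Lemma curve_f2 : curve f2 = 0.
Proof.
rewrite /f2 curveB !curveM !curveXn curve_x1 curve_x2 curve_x3.
by rewrite -!exprM -!exprD; apply/eqP; rewrite subr_eq0; apply/eqP; congr 'X^_; lia.
Qed.

Lemma curve_f3 : curve f3 = 0.
Proof.
rewrite /f3 curveB !curveM !curveXn curve_x1 curve_x2 curve_x3.
by rewrite -!exprM -!exprD; apply/eqP; rewrite subr_eq0; apply/eqP; congr 'X^_; lia.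
Qed.

Definition gen_ideal (f : T) : Prop := exists a b c, f = a * f1 + b * f2 + c * f3.

Lemma gen_idealD f h : gen_ideal f -> gen_ideal h -> gen_ideal (f + h).
Proof.
move=> [a [b [c ->]]] [a' [b' [c' ->]]].
by exists (a + a'), (b + b'), (c + c'); ring.
Qed.

Lemma gen_idealM f h : gen_ideal f -> gen_ideal (h * f).
Proof.
by move=> [a [b [c ->]]]; exists (h * a), (h * b), (h * c); ring.
Qed.

Lemma gen_ideal_f1 : gen_ideal f1.
Proof. by exists 1, 0, 0; ring. Qed.

Lemma gen_ideal_f2 : gen_ideal f2.
Proof. by exists 0, 1, 0; ring. Qed.

Lemma gen_ideal_f3 : gen_ideal f3.
Proof. by exists 0, 0, 1; ring. Qed.

Lemma gen_ideal_Delta : gen_ideal D.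
Proof. by exists (y * x2), (- (x1 * y)), x3; rewrite DeltaE; ring. Qed.

(** Positive order comes from a factor f1 or Delta, or else from a basis factor f2, f3 or x2 f3. *)
Lemma gen_ideal_gmon a : (0 < gord a)%N -> gen_ideal (gmon k m a).
Proof.
rewrite /gord /gmon; set u := (a i2 %/ 2)%N; set v := (a i3 %/ 3)%N.
have := ltn_pmod (a i2) (isT : 0 < 2)%N; have := ltn_pmod (a i3) (isT : 0 < 3)%N.
move: (a i2 %% 2)%N (a i3 %% 3)%N => e d hd he H.
case: u H => [|u] H; last first.
  rewrite exprS (_ : _ * _ = x1 ^+ a i1 * f1 ^+ u * D ^+ v * fbasis k m e d * f1); last by ring.
  exact/gen_idealM/gen_ideal_f1.
case: v H => [|v] H; last first.
  rewrite exprS (_ : _ * _ = x1 ^+ a i1 * f1 ^+ 0 * D ^+ v * fbasis k m e d * D); last by ring.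
  exact/gen_idealM/gen_ideal_Delta.
apply: gen_idealM; case: e d hd he H => [|[|//]] [|[|[|//]]] _ _ //= _.
- exact: gen_ideal_f3.
- exact: gen_ideal_f2.
- exact/gen_idealM/gen_ideal_f3.
Qed.

Lemma curve_gen_ideal f : gen_ideal f -> curve f = 0.
Proof.
case=> a [b [c ->]].
by rewrite !curveD !curveM curve_f1 curve_f2 curve_f3 !mulr0 !addr0.
Qed.

Hypothesis gcd3m : gcdn 3 m = 1%N.

Lemma m_mod3 : (m %% 3 != 0)%N.
Proof.
by apply/negP => h; move: gcd3m; rewrite (gcdn_idPl h).
Qed.

Lemma gord_eq0 a : gord a = 0%N ->
  [\/ a i2 = 0 /\ a i3 = 0, a i2 = 1 /\ a i3 = 0 | a i2 = 0 /\ a i3 = 1]%N.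
Proof.
rewrite /gord => h; have {h} : (a i2 + a i3 <= 1)%N by lia.
case: (a i2) (a i3) => [|[|u]] [|[|v]] h.
- by constructor 1.
- by constructor 3.
- by lia.
- by constructor 2.
all: by lia.
Qed.

(** Order 0 leaves x1^i, x1^i x2 and x1^i x3, whose degrees are congruent to 0, m and 2 m modulo 3;
    these classes differ because 3 does not divide m. *)
Lemma curve_mon_inj a b : gord a = 0%N -> gord b = 0%N ->
  wdeg (curve_wt m) a = wdeg (curve_wt m) b -> a = b.
Proof.
move=> /gord_eq0 ha /gord_eq0 hb; rewrite !curve_wdeg; have m3 := m_mod3.
case: ha => -[u2 u3]; case: hb => -[h2 h3]; rewrite u2 u3 h2 h3 => e.
all: try by exfalso; lia.
all: apply: mnm3P; rewrite ?u2 ?u3 ?h2 ?h3; lia.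
Qed.

(** The part of positive order lies in the ideal of the minors. The rest combines monomials with
    distinct images in k[t], so it vanishes with its image. *)
Lemma curve_ideal_gens f : curve f = 0 -> gen_ideal f.
Proof.
have [b _ ->] := @filtT k m f => f0.
have [g [h [bE Hg Hh]]] := vanish_split (fun a => gord a < 1)%N b.
have Jg : gen_ideal (theta g).
  rewrite /theta /mon_ext big_seq; elim/big_ind: _ => [||a].
  - by exists 0, 0, 0; ring.
  - exact: gen_idealD.
  move/vanishP: Hg => /[apply]; rewrite -leqNgt => /gen_ideal_gmon Ja.
  by rewrite -mul_mpolyC; apply: gen_idealM.
suff -> : b = g by [].
(* For [a] of order 0, [gmon a] is the monomial [a] itself. *)
have hE : theta h = h.
  rewrite [RHS]mpolyE /theta /mon_ext; rewrite !big_seq; apply: eq_bigr => a.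
  move/vanishP: Hh => /[apply] /=; rewrite negbK ltnS leqn0 => /eqP a0.
  congr (_ *: _); rewrite -[in RHS](mon3K a) mpolyX_mon3 /gmon.
  case: (gord_eq0 a0) => -[-> ->]; first by rewrite !expr0 /= !mulr1.
  - by rewrite !expr0 expr1 /= !mulr1.
  - by rewrite !expr0 expr1 /= !mulr1.
suff h0 : h = 0 by rewrite bE h0 addr0.
have ch : curve h = 0.
  by move: f0; rewrite bE /theta mon_extD curveD -/theta (curve_gen_ideal Jg) add0r hE.
apply/eqP; rewrite -msupp_eq0; apply/negPn/negP.
case E : (msupp h) => [//|a s] _.
have ah : a \in msupp h by rewrite E inE eqxx.
have gh0 c : c \in msupp h -> gord c = 0%N.
  by move/vanishP: Hh => /[apply] /=; rewrite negbK ltnS leqn0 => /eqP.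
have : (curve h)`_(wdeg (curve_wt m) a) = mcoeff a h.
  rewrite {1}[h]mpolyE curve_sum coef_sum (bigD1_seq a) ?msupp_uniq //=.
  rewrite curveZ curve_mon coefZ coefXn eqxx mulr1 big_seq_cond big1 ?addr0 //.
  move=> c /andP[ch' ca]; rewrite curveZ curve_mon coefZ coefXn.
  case: eqP => [e|_]; last by rewrite mulr0.
  by move: ca; rewrite (curve_mon_inj (gh0 _ ah) (gh0 _ ch') e) eqxx.
rewrite ch coef0 => /esym /eqP; rewrite mcoeff_eq0.
by rewrite ah.
Qed.

Lemma filt_curve_ideal h n f : curve h = 0 -> filt m n f -> filt m n.+1 (h * f).
Proof.
move=> /curve_ideal_gens [a [b [c ->]]] Hf.
rewrite !mulrDl -!mulrA; do 2?apply: filtD; apply: filt_mulT.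
- exact: filt_f1.
- by have := filt_f2 Hf; rewrite addn1.
- by have := filt_f3 Hf; rewrite addn1.
Qed.

Lemma filt_ideal_pow n f : ideal_pow (curve_ideal k m) n f -> filt m n f.
Proof.
elim: n f => [|n IH] f; first by move=> _; apply: filtT.
case=> N [a [b [Ha [Hb ->]]]].
by apply: filt_sum => l; apply: filt_curve_ideal; [exact: Ha|apply: IH; exact: Hb].
Qed.

End CurveIdeal.

(* The n + 1 powers 'X^(d i) with i <= n are dependent modulo a polynomial of
   degree n. *)
Lemma dvdp_comp_Xn (k : fieldType) (d : nat) (q : {poly k}) : q != 0 ->
  exists2 c : {poly k}, c != 0 & q %| c \Po 'X^d.
Proof.
move=> q0; set n := size q.
have n_gt0 : (0 < n)%N by rewrite size_poly_gt0.
pose A : 'M[k]_(n, n.-1) := \matrix_i poly_rV ('X^(d * i) %% q).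
(* [A] has one row more than it has columns; a relation between its rows, the remainders of the
   powers, gives the coefficients of [c]. *)
have : kermx A != 0.
  rewrite kermx_eq0 /row_free neq_ltn.
  by rewrite (leq_ltn_trans (rank_leq_col A)) // ltn_predL.
case/rowV0Pn => u /sub_kermxP uA /rV0Pn [i ui].
exists (\sum_(j < n) u 0 j *: 'X^j).
  apply/eqP => /(congr1 (fun p : {poly k} => p`_i)); rewrite coef0 coef_sum.
  rewrite (bigD1 i) //= big1 => [|j ji].
    by rewrite addr0 coefZ coefXn eqxx mulr1 => /eqP; rewrite (negPf ui).
  rewrite coefZ coefXn; case: eqP => [e|_]; last by rewrite mulr0.
  by move: ji; rewrite -val_eqE /= e eqxx.
rewrite /dvdp linear_sum /= (big_morph _ (modpD q) (mod0p q)).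
suff -> : \sum_(j < n) ((u 0 j *: 'X^j) \Po 'X^d) %% q = rVpoly (u *m A).
  by rewrite uA linear0.
rewrite mulmx_sum_row linear_sum; apply: eq_bigr => j _ /=.
rewrite linearZ rowK /= [RHS]linearZ /= poly_rV_K ?modpZl ?comp_Xn_poly -?exprM //.
by rewrite -ltnS prednK // ltn_modp.
Qed.

(** * Cancellation of elements outside p, and symbolic powers *)

Section Saturation.
Variables (k : fieldType) (m : nat).
Local Notation T := (mpoly 3 k).
Local Notation x1 := (mpolyX k (mnm1 i1)).
Local Notation x2 := (mpolyX k (mnm1 i2)).
Local Notation x3 := (mpolyX k (mnm1 i3)).
Local Notation theta := (theta m).
Local Notation curve := (@curve_map k m).

Definition px1 (c : {poly k}) : T := \sum_(i < size c) c`_i *: x1 ^+ i.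

Lemma curve_px1 c : curve (px1 c) = c \Po 'X^3.
Proof.
rewrite /px1 curve_sum comp_polyE; apply: eq_bigr => i _.
by rewrite curveZ curveXn curve_x1.
Qed.

Lemma theta_px1 c f : theta (px1 c * f) = px1 c * theta f.
Proof.
rewrite /px1 !mulr_suml /theta raddf_sum /=; apply: eq_bigr => i _.
rewrite -!mul_mpolyC -!mulrA mul_mpolyC mon_extZ -mul_mpolyC; congr (_ * _).
elim: (i : nat) => [|j IH]; first by rewrite !mul1r.
by rewrite !exprS -!mulrA -IH; apply: theta_x1.
Qed.

Lemma vanish_px1 (P : pred (multinom 3)) c f :
  (forall a, P (mnm_add (mnm1 i1) a) -> P a) -> vanish P f -> vanish P (px1 c * f).
Proof.
move=> HP Hf; rewrite /px1 mulr_suml; apply: vanish_sum => i _.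
rewrite -mul_mpolyC -mulrA mul_mpolyC; apply: vanishZ.
elim: (i : nat) => [|j IH]; first by rewrite mul1r.
rewrite exprS -mulrA; apply/vanishP => a; rewrite mulrC (perm_mem (msuppMX _ _)).
case/mapP => b; move/vanishP: IH => /[apply] H ->.
by apply: contra H => /HP.
Qed.

(** A polynomial in x1 commutes with [theta], and x1 preserves [gord]. The coordinates of [f] of
    order below [n] therefore have a product with [px1 c] whose coordinates are at once all below
    [n] and all at least [n], so it is 0. *)
Lemma filt_cancel c n f : px1 c != 0 -> filt m n (px1 c * f) -> filt m n f.
Proof.
move=> c0; have [b _ ->] := @filtT k m f.
have [g [h [-> Hg Hh]]] := vanish_split (fun a => gord a < n)%N b.
have Fg : filt m n (theta g) by exists g.
rewrite /theta mon_extD -/(theta g) -/(theta h) => H.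
suff -> : h = 0 by rewrite /theta mon_ext0 addr0.
have : filt m n (px1 c * theta h).
  rewrite [X in filt _ _ X](_ : _ = px1 c * (theta g + theta h) - px1 c * theta g); last by ring.
  by apply: filtB => //; apply: filt_mulT.
case=> d Hd; rewrite -theta_px1 => /theta_inj e.
have /eqP : px1 c * h = 0.
  apply: (@vanish_disjoint _ _ (fun a => gord a < n)%N); first by rewrite e.
  by apply: vanish_px1 Hh => a; rewrite /= gord_x1 addn0.
by rewrite mulf_eq0 (negPf c0) => /eqP.
Qed.

Hypothesis gcd3m : gcdn 3 m = 1%N.

(* 3 (m + 1) is at least the conductor of the semigroup generated by 3, 3 + m, 3 + 2 m. *)
Lemma curve_conductor q : exists s, curve s = 'X^(3 * m.+1) * q.
Proof.
have m3 := m_mod3 gcd3m.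
have mono i : exists s, curve s = 'X^(3 * m.+1 + i).
  suff [a e] : exists a, wdeg (curve_wt m) a = (3 * m.+1 + i)%N.
    by exists (mpolyX k a); rewrite curve_mon e.
  have [i0|i0|i0] : [\/ i %% 3 = 0, i %% 3 = m %% 3 | i %% 3 = (2 * m) %% 3]%N.
  - have : (m %% 3 = 1 \/ m %% 3 = 2)%N by lia.
    have : (i %% 3 = 0 \/ i %% 3 = 1 \/ i %% 3 = 2)%N by lia.
    by case=> [h|[h|h]] [h'|h'];
      [constructor 1|constructor 1|constructor 2|constructor 3|constructor 3|constructor 2]; lia.
  - by exists (mon3 ((3 * m.+1 + i) %/ 3) 0 0); rewrite curve_wdeg !mon3E; lia.
  - by exists (mon3 ((3 * m.+1 + i - (3 + m)) %/ 3) 1 0); rewrite curve_wdeg !mon3E; lia.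
  - by exists (mon3 ((3 * m.+1 + i - (3 + 2 * m)) %/ 3) 0 1); rewrite curve_wdeg !mon3E; lia.
have [s Hs] := choice mono.
exists (\sum_(i < size q) q`_i *: s i); rewrite curve_sum.
rewrite -[in RHS](comp_polyXr q) comp_polyE mulr_sumr; apply: eq_bigr => i _.
by rewrite curveZ Hs exprD scalerAr.
Qed.

(* Modulo p, [s] divides a nonzero polynomial in x1, so [f] climbs the filtration
   one step at a time. *)
Lemma filt_saturated s n f : curve s != 0 -> filt m n (s * f) -> filt m n f.
Proof.
move=> s0 Hsf; have [c c0 /dvdpP [q' cE]] := dvdp_comp_Xn 3 s0.
have [s' Hs'] := curve_conductor q'.
(* Composed with 'X^3, the added factor becomes t^(3 (m + 1)), which brings [q'] into the image of
   T. *)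
pose c' := c * 'X^(m.+1).
have c'E : curve (s * s') = c' \Po 'X^3.
  rewrite curveM Hs' /c' comp_polyM comp_Xn_poly cE exprM; ring.
have c'0 : px1 c' != 0.
  apply/eqP => /(congr1 curve); rewrite curve_px1 /curve_map raddf0 => /eqP.
  rewrite comp_poly_eq0 ?size_polyXn // mulf_eq0 (negPf c0) /=.
  by rewrite expf_eq0 polyX_eq0.
suff H l : (l <= n)%N -> filt m l f by apply: H.
elim: l => [|l IH] ln; first exact: filtT.
apply: (filt_cancel c'0).
(* The first term lies in step [n]; in the second, the factor in p lifts [f] from step [l] to the
   next. *)
rewrite (_ : px1 c' * f = s' * (s * f) - (s * s' - px1 c') * f); last by ring.
apply: filtB; first by apply: filt_mulT; apply: filt_le Hsf.
apply: filt_curve_ideal => //; last by apply: IH; lia.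
by rewrite curveB c'E curve_px1 subrr.
Qed.

(** Clearing the denominator gives [s] outside p with [s * f] in p^n, hence in the n-th step, and
    saturation removes [s]. *)
Lemma symbolic_pow_filt n f : symbolic_pow (curve_ideal k m) n f -> filt m n f.
Proof.
case=> a [s [Ha Hs e]].
have s0 : s != 0 by apply/eqP => s0; apply: Hs; rewrite s0 /curve_ideal /= /curve_map raddf0.
apply: (@filt_saturated s); first by apply/eqP.
suff -> : s * f = a by apply: filt_ideal_pow.
by apply/eqP; rewrite -tofrac_eq tofracM e mulrC divfK // tofrac_eq0.
Qed.

End Saturation.

(** * Arithmetic of the powers of an ideal *)

Section IdealPowers.
Variables (A : idomainType) (I : set A).
Hypothesis IM : forall a b, I b -> I (a * b).

Lemma ideal_powM1 n a b : I a -> ideal_pow I n b -> ideal_pow I n.+1 (a * b).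
Proof.
move=> Ia Ib; exists 1%N, (fun=> a), (fun=> b); split=> //; split=> //.
by rewrite big_ord1.
Qed.

Lemma ideal_pow0 n : ideal_pow I n 0.
Proof.
case: n => [//|n]; exists 0%N, (fun=> 0), (fun=> 0).
by split; [case|split; [case|rewrite big_ord0]].
Qed.

Lemma ideal_powD n a b : ideal_pow I n a -> ideal_pow I n b -> ideal_pow I n (a + b).
Proof.
case: n => [//|n] [N [u [v [Hu [Hv ->]]]]] [M [u' [v' [Hu' [Hv' ->]]]]].
exists (N + M)%N, (fun i => match fintype.split i with inl j => u j | inr j => u' j end),
  (fun i => match fintype.split i with inl j => v j | inr j => v' j end).
split; [by move=> i; case: fintype.split|split; [by move=> i; case: fintype.split|]].
rewrite big_split_ord /=; congr (_ + _); apply: eq_bigr => i _.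
- by rewrite (unsplitK (inl i)).
- by rewrite (unsplitK (inr i)).
Qed.

Lemma ideal_powMl n a b : ideal_pow I n b -> ideal_pow I n (a * b).
Proof.
case: n => [//|n] [N [u [v [Hu [Hv ->]]]]]; rewrite mulr_sumr.
exists N, (fun i => a * u i), v; split; first by move=> i; apply: IM.
by split=> //; apply: eq_bigr => i _; rewrite mulrA.
Qed.

Lemma ideal_powM i j a b :
  ideal_pow I i a -> ideal_pow I j b -> ideal_pow I (i + j) (a * b).
Proof.
move=> Ha Hb; elim: i a Ha => [|i IH] a; first by move=> _; apply: ideal_powMl.
case=> N [u [v [Hu [Hv ->]]]]; rewrite mulr_suml.
elim/big_ind: _ => [||l _]; [exact: ideal_pow0|exact: ideal_powD|].
by rewrite -mulrA addSn; apply: ideal_powM1 (Hu l) _; apply: IH; apply: Hv.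
Qed.

Lemma ideal_pow_le n l a : (l <= n)%N -> ideal_pow I n a -> ideal_pow I l a.
Proof.
move=> ln; rewrite -(subnK ln); elim: (n - l)%N a => [//|d IH] a [N [u [v [Hu [Hv ->]]]]].
elim/big_ind: _ => [||i _]; [exact: ideal_pow0|exact: ideal_powD|].
by apply: ideal_powMl; apply: IH; apply: Hv.
Qed.

Lemma ideal_powX i a j : ideal_pow I i a -> ideal_pow I (i * j) (a ^+ j).
Proof.
move=> Ha; elim: j => [|j IH]; first by rewrite muln0.
by rewrite mulnS exprS; apply: ideal_powM.
Qed.

Lemma ideal_pow1 a : I a -> ideal_pow I 1 a.
Proof. by move=> Ia; rewrite -[a]mulr1; apply: ideal_powM1. Qed.

End IdealPowers.

(** * The upper bound 4/3 for the resurgence *)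

Section Resurgence.
Variables (k : fieldType) (m : nat).
Local Notation T := (mpoly 3 k).
Local Notation p := (curve_ideal k m).

Lemma curve_idealM f h : p h -> p (f * h).
Proof. by rewrite /curve_ideal /= curveM => ->; rewrite mulr0. Qed.

Local Notation "I ^^ n" := (ideal_pow I n) (at level 30).

Let powM i j f h : (p ^^ i) f -> (p ^^ j) h -> (p ^^ (i + j)) (f * h).
Proof. exact: (ideal_powM curve_idealM). Qed.

Let powMl i f h : (p ^^ i) h -> (p ^^ i) (f * h).
Proof. exact: (ideal_powMl curve_idealM). Qed.

Let powX i j f : (p ^^ i) f -> (p ^^ (i * j)) (f ^+ j).
Proof. exact: (ideal_powX curve_idealM). Qed.

Let pow_f1 : (p ^^ 1) (f1 k).
Proof. by apply: ideal_pow1; exact: curve_f1. Qed.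

Let pow_f2 : (p ^^ 1) (f2 k m).
Proof. by apply: ideal_pow1; exact: curve_f2. Qed.

Let pow_f3 : (p ^^ 1) (f3 k m).
Proof. by apply: ideal_pow1; exact: curve_f3. Qed.

Let pow_Delta : (p ^^ 1) (Delta k m).
Proof. by apply: ideal_pow1; exact/curve_gen_ideal/gen_ideal_Delta. Qed.

(** The adjugate of the circulant with determinant Delta is the circulant of X^2 - Y Z = f3, Y^2 - X
    Z = y^(2/3) f1 and Z^2 - X Y = - y^(1/3) f2. Its determinant is the same cubic form in these
    entries, and equals Delta^2. *)
Lemma pow_Delta2 : (p ^^ 3) (Delta k m ^+ 2).
Proof.
have -> : Delta k m ^+ 2 = 1 * (f3 k m ^+ 3)
    + (3%:R * mpolyX k (mnm1 i1) ^+ m) * (f1 k * f2 k m * f3 k m)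
    + (- mpolyX k (mnm1 i1) ^+ m) * (f2 k m ^+ 3)
    + mpolyX k (mnm1 i1) ^+ m ^+ 2 * (f1 k ^+ 3).
  by rewrite /Delta /f1 /f2 /f3; ring.
do 3?apply: ideal_powD; apply: powMl.
- exact: (@powX 1 3).
- exact: (@powM 2 1 _ _ (@powM 1 1 _ _ _ _)).
- exact: (@powX 1 3).
- exact: (@powX 1 3).
Qed.

(** Two factors Delta have order 4 and lie in p^3, a leftover Delta has order 2 and lies in p, and
    the other factors lose nothing. So a basis element of order at least n lies in p^q with 4 q >= 3
    n - 2, and 4 r < 3 n then forces r <= q. *)
Lemma filt_pow n r f : (4 * r < 3 * n)%N -> filt m n f -> (p ^^ r) f.
Proof.
move=> rn [b /vanishP Hb ->].
rewrite /theta /mon_ext big_seq; elim/big_ind: _ => [||a /Hb].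
- exact: ideal_pow0.
- exact: ideal_powD.
rewrite -leqNgt -mul_mpolyC => ab; apply: powMl; move: ab; rewrite /gord /gmon.
set u := (a i2 %/ 2)%N; set v := (a i3 %/ 3)%N.
have := ltn_pmod (a i2) (isT : 0 < 2)%N; have := ltn_pmod (a i3) (isT : 0 < 3)%N.
move: (a i2 %% 2)%N (a i3 %% 3)%N => e d hd he nuv.
apply: (ideal_pow_le curve_idealM (n := u + (3 * (v %/ 2) + v %% 2) + (e + d) %/ 2)); first by lia.
apply: powM; first (rewrite -mulrA; apply/powMl/powM).
- by have := powX u pow_f1; rewrite mul1n.
- have -> : Delta k m ^+ v = Delta k m ^+ 2 ^+ (v %/ 2) * Delta k m ^+ (v %% 2).
    by rewrite -exprM -exprD mulnC -divn_eq.
  apply: powM; first exact: powX pow_Delta2.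
  by have := powX (v %% 2) pow_Delta; rewrite mul1n.
case: e d hd he {nuv} => [|[|//]] [|[|[|//]]] _ _ //=.
exact: (@powMl 1).
Qed.

Hypothesis gcd3m : gcdn 3 m = 1%N.

Lemma resurgence_le (R : realType) : (resurgence R p <= (4%:R / 3%:R)%:E)%E.
Proof.
apply: ge_ereal_sup => _ [n [r [n1 r1 npr ->]]].
rewrite lee_fin ler_pdivrMr ?ltr0n // mulrAC ler_pdivlMr ?ltr0n // -!natrM ler_nat.
rewrite leqNgt; apply/negP => h; apply: npr => f /(symbolic_pow_filt gcd3m).
by apply: filt_pow; lia.
Qed.

End Resurgence.

(** The first hypothesis expresses that the two monomials are coprime. *)
Lemma dvd_coprime_mon (k : fieldType) n (a b : multinom n) (f h : mpoly n k) :
  (forall c, mpoly.lem b (mnm_add a c) -> mpoly.lem b c) ->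
  mpolyX k a * f = mpolyX k b * h -> exists g, f = mpolyX k b * g.
Proof.
move=> ab e; apply: vanish_dvd => c bc.
rewrite -(mcoeffMX f a) mulrC e vanish_XM //.
by apply: contra bc => H; apply: ab.
Qed.

(** * The Hilbert-Burch resolution of p *)

Section Resolution.
Variables (k : fieldType) (m : nat).
Local Notation T := (mpoly 3 k).
Local Notation x1 := (mpolyX k (mnm1 i1)).
Local Notation x2 := (mpolyX k (mnm1 i2)).
Local Notation x3 := (mpolyX k (mnm1 i3)).
Local Notation y := (x1 ^+ m).
Local Notation f1 := (f1 k).
Local Notation f2 := (f2 k m).
Local Notation f3 := (f3 k m).
Local Notation D := (Delta k m).

Lemma mpolyX_neq0 n (a : multinom n) : mpolyX k a != 0.
Proof.
apply/eqP => /(congr1 (mcoeff a)) /eqP.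
by rewrite mcoeff0 mcoeffX eqxx oner_eq0.
Qed.

Lemma f1_neq0 : f1 != 0.
Proof.
apply/eqP => e; have := @leads_f1 k (mnm_muln (mnm1 i2) 2) (leqnn _).
rewrite e sub0r mcoeffN mcoeffX eqxx => /eqP.
by rewrite oppr_eq0 oner_eq0.
Qed.

(* As x1 Delta = f2^2 modulo f1, this makes f2 regular modulo f1. *)
Lemma dvd_f1 g c : x1 * D * g = f1 * c -> exists h, g = f1 * h.
Proof.
have [b _ ->] := @filtT k m g; have [d _ ->] := @filtT k m c.
(* In the coordinates of [theta] the equation reads x1 x3^3 b = x2^2 d, with coprime monomials. *)
rewrite -mulrA -theta_x33 -theta_x1 -theta_x22 => /theta_inj e.
suff [h ->] : exists h, b = x2 ^+ 2 * h by exists (theta m h); rewrite theta_x22.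
rewrite mpolyXn.
apply: (@dvd_coprime_mon _ _ (mon3 1 0 3) _ _ d); last first.
  by rewrite -mpolyXn -e mpolyX_mon3; ring.
move=> u /mnm_lepP H; apply/mnm_lepP => i.
move: {H}(H i); rewrite mnmDE !mulmnE !mnm1E /=.
case: eqP => [<-|_ _]; last by rewrite mul0n.
by rewrite mon3E.
Qed.

(** By x1 f3 = x2 f2 - x3 f1, x1 times a syzygy becomes w1 f1 + w2 f2 = 0. Regularity of f2 modulo
    f1 makes this a Koszul relation with factor h; the definition of w2 then yields u, as x1 and x2
    are coprime. *)
Lemma syzygies v1 v2 v3 : v1 * f1 + v2 * f2 + v3 * f3 = 0 ->
  exists u1 u2, [/\ v1 = - u1 * x3 - u2 * (x1 * y), v2 = u1 * x2 + u2 * x3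
                 & v3 = - u1 * x1 - u2 * x2].
Proof.
move=> e.
have x1n0 := mpolyX_neq0 (mnm1 i1).
pose w1 := x1 * v1 - x3 * v3; pose w2 := x1 * v2 + x2 * v3.
have ew : w2 * f2 = - w1 * f1.
  apply/eqP; rewrite -subr_eq0; apply/eqP.
  rewrite (_ : _ - _ = x1 * (v1 * f1 + v2 * f2 + v3 * f3)); last first.
    by rewrite /w1 /w2 /f1 /f2 /f3; ring.
  by rewrite e mulr0.
have [h hE] : exists h, w2 = f1 * h.
  (* The cofactor comes from x1 Delta = f2^2 - f1 f3 and w2 f2 = - w1 f1. *)
  apply: (@dvd_f1 _ (- w1 * f2 - w2 * f3)).
  rewrite mulx1D (_ : _ * w2 = w2 * f2 * f2 - f1 * w2 * f3); last by ring.
  by rewrite ew; ring.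
have w1E : w1 = - h * f2.
  apply: (mulIf f1_neq0); apply: oppr_inj; rewrite -mulNr -ew hE; ring.
have ez : x2 * (h * x2 - v3) = x1 * (v2 + x3 * h).
  apply/eqP; rewrite -subr_eq0; apply/eqP.
  rewrite (_ : _ - _ = f1 * h - w2); last by rewrite /w2 /f1; ring.
  by rewrite hE subrr.
have [u uE] : exists u, h * x2 - v3 = x1 * u.
  apply: dvd_coprime_mon ez => c /mnm_lepP H; apply/mnm_lepP => i.
  move: {H}(H i); rewrite mnmDE !mnm1E.
  by case: eqP => [<-|].
have v3E : v3 = h * x2 - x1 * u by rewrite -uE; ring.
exists u, (- h); split.
- apply: (mulfI x1n0).
  rewrite (_ : x1 * v1 = w1 + x3 * v3); last by rewrite /w1; ring.
  by rewrite w1E v3E /f2; ring.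
- apply: (mulfI x1n0).
  rewrite (_ : x1 * v2 = w2 - x2 * v3); last by rewrite /w2; ring.
  by rewrite hE v3E /f1; ring.
- by rewrite v3E; ring.
Qed.

(** The determinant of the system is f1, so Cramer's rule gives u2 f1 = 0. *)
Lemma syzygies_free u1 u2 : - u1 * x1 - u2 * x2 = 0 -> u1 * x2 + u2 * x3 = 0 ->
  u1 = 0 /\ u2 = 0.
Proof.
move=> e1 e2.
have u20 : u2 = 0.
  apply: (mulIf f1_neq0); rewrite mul0r.
  rewrite (_ : u2 * f1 = - x2 * (- u1 * x1 - u2 * x2) - x1 * (u1 * x2 + u2 * x3));
    last by rewrite /f1; ring.
  by rewrite e1 e2; ring.
split=> //; apply: (mulIf (mpolyX_neq0 (mnm1 i2))).
by move: e2; rewrite u20 !mul0r addr0.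
Qed.

Definition hb_rank (i : nat) : nat := match i with 0 => 3 | 1 => 2 | _ => 0 end%N.

(** Degrees of f1, f2, f3 in F_0 and of their two syzygies in F_1: p is resolved, rather than
    T/p. *)
Definition hb_shift i (j : 'I_(hb_rank i)) : int :=
  if i is 0%N then (6 + (2 + j) * m)%N%:Z else (9 + (4 + j) * m)%N%:Z.

Definition hb_gen (j : nat) : T :=
  match j with 0%N => f1 | 1%N => f2 | _ => f3 end.

(** Maps act on row vectors, so the rows are the syzygies; up to sign the maximal minors of this 2 x
    3 matrix are the generators. *)
Definition hb_entry (i j l : nat) : T :=
  match i, j, l with
  | 0%N, 0%N, 0%N => - x3
  | 0%N, 0%N, 1%N => x2
  | 0%N, 0%N, 2%N => - x1
  | 0%N, 1%N, 0%N => - (x1 * y)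
  | 0%N, 1%N, 1%N => x3
  | 0%N, 1%N, 2%N => - x2
  | _, _, _ => 0
  end.

Definition hb_cpx : free_cpx k 3 :=
  @FreeCpx k 3 hb_rank hb_shift (\col_j hb_gen j) (fun i => \matrix_(j, l) hb_entry i j l).

Lemma sum_ord3 (V : nmodType) (F : 'I_3 -> V) : \sum_(i < 3) F i = F i1 + F i2 + F i3.
Proof.
rewrite !big_ord_recl big_ord0 addr0 addrA.
by congr (_ + F _ + F _); apply: val_inj.
Qed.

Local Notation j1 := (ord0 : 'I_2).
Local Notation j2 := (ord_max : 'I_2).

Lemma sum_ord2 (V : nmodType) (F : 'I_2 -> V) : \sum_(i < 2) F i = F j1 + F j2.
Proof.
rewrite !big_ord_recl big_ord0 addr0.
by congr (_ + F _); apply: val_inj.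
Qed.

Lemma hb_augE (v : 'rV_3) :
  (v *m faug hb_cpx) 0 0 = v 0 i1 * f1 + v 0 i2 * f2 + v 0 i3 * f3.
Proof. by rewrite mxE sum_ord3 !mxE. Qed.

Lemma hb_diffE (u : 'rV_2) :
  [/\ (u *m fdiff hb_cpx 0) 0 i1 = - u 0 j1 * x3 - u 0 j2 * (x1 * y),
      (u *m fdiff hb_cpx 0) 0 i2 = u 0 j1 * x2 + u 0 j2 * x3
    & (u *m fdiff hb_cpx 0) 0 i3 = - u 0 j1 * x1 - u 0 j2 * x2].
Proof. by split; rewrite mxE sum_ord2 !mxE /= ?mulrN ?mulNr. Qed.

Lemma rV3P (v w : 'rV[T]_3) :
  v 0 i1 = w 0 i1 -> v 0 i2 = w 0 i2 -> v 0 i3 = w 0 i3 -> v = w.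
Proof.
move=> h1 h2 h3; apply/rowP => -[[|[|[|//]]] h].
- by rewrite (_ : Ordinal h = i1) //; apply: val_inj.
- by rewrite (_ : Ordinal h = i2) //; apply: val_inj.
- by rewrite (_ : Ordinal h = i3) //; apply: val_inj.
Qed.

Lemma rV2P (v w : 'rV[T]_2) : v 0 j1 = w 0 j1 -> v 0 j2 = w 0 j2 -> v = w.
Proof.
move=> h1 h2; apply/rowP => -[[|[|//]] h].
- by rewrite (_ : Ordinal h = j1) //; apply: val_inj.
- by rewrite (_ : Ordinal h = j2) //; apply: val_inj.
Qed.

Hypothesis gcd3m : gcdn 3 m = 1%N.

Lemma hb_resolves : resolves hb_cpx (curve_ideal k m).
Proof.
split.
- move=> f; split.
    move=> /(curve_ideal_gens gcd3m) [a [b [c ->]]].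
    exists (\row_(i < 3) nth 0 [:: a; b; c] i).
    by rewrite hb_augE !mxE.
  by case=> v ->; rewrite hb_augE; apply: curve_gen_ideal; do 3 eexists.
- move=> v; split.
    move=> e; have /syzygies [u1 [u2 [h1 h2 h3]]] :
        v 0 i1 * f1 + v 0 i2 * f2 + v 0 i3 * f3 = 0 by rewrite -hb_augE e mxE.
    exists (\row_(i < 2) nth 0 [:: u1; u2] i).
    have [e1 e2 e3] := hb_diffE (\row_(i < 2) nth 0 [:: u1; u2] i).
    by apply: rV3P; rewrite ?e1 ?e2 ?e3 !mxE.
  case=> u ->; apply/matrixP => i j; rewrite !ord1 hb_augE.
  have [-> -> ->] := hb_diffE u.
  by rewrite mxE /f1 /f2 /f3; ring.
- case=> [|i] v; last first.
    split=> _; last by rewrite [v]thinmx0 mul0mx.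
    by exists 0; rewrite [v]thinmx0 mul0mx.
  split=> [e|[u ->]]; last by rewrite [u]thinmx0 !mul0mx.
  exists 0; rewrite mul0mx.
  have [_ e2 e3] := hb_diffE v; move: e2 e3; rewrite e !mxE => e2 e3.
  have [v1 v2] := syzygies_free (esym e3) (esym e2).
  by apply: rV2P; rewrite ?v1 ?v2 mxE.
Qed.

End Resolution.

(** * Bounds for the regularity and the Waldschmidt constant *)

Section Invariants.
Variables (k : fieldType) (m : nat).
Local Notation T := (mpoly 3 k).
Local Notation w := (curve_wt m).
Local Notation homog d := (@ishomog1 3 k d (wdeg w)).
Local Notation x1 := (mpolyX k (mnm1 i1)).
Local Notation x2 := (mpolyX k (mnm1 i2)).
Local Notation x3 := (mpolyX k (mnm1 i3)).

Lemma homog_mon d a u v : (a * 3 + u * (3 + m) + v * (3 + 2 * m) = d)%N ->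
  x1 ^+ a * x2 ^+ u * x3 ^+ v \is homog d.
Proof. by move=> <-; rewrite -mpolyX_mon3 dhomogX /= curve_wdeg !mon3E. Qed.

Lemma homog_gen j : (j < 3)%N -> hb_gen k m j \is homog (6 + (2 + j) * m).
Proof.
case: j => [|[|[|//]]] _ /=.
- rewrite (_ : f1 k = x1 ^+ 0 * x2 ^+ 2 * x3 ^+ 0
    - x1 ^+ 1 * x2 ^+ 0 * x3 ^+ 1); last first.
    by rewrite /f1; ring.
  by apply: rpredB; apply: homog_mon; lia.
- rewrite (_ : f2 k m = x1 ^+ 0 * x2 ^+ 1 * x3 ^+ 1
    - x1 ^+ (2 + m) * x2 ^+ 0 * x3 ^+ 0); last first.
    by rewrite /f2 exprD; ring.
  by apply: rpredB; apply: homog_mon; lia.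
- rewrite (_ : f3 k m = x1 ^+ 0 * x2 ^+ 0 * x3 ^+ 2
    - x1 ^+ (1 + m) * x2 ^+ 1 * x3 ^+ 0); last first.
    by rewrite /f3 exprD; ring.
  by apply: rpredB; apply: homog_mon; lia.
Qed.

Lemma homog_entry j l : (j < 2)%N -> (l < 3)%N ->
  hb_entry k m 0 j l \is homog (9 + (4 + j) * m - (6 + (2 + l) * m)).
Proof.
have H a u v d : (a * 3 + u * (3 + m) + v * (3 + 2 * m) = d)%N ->
    - (x1 ^+ a * x2 ^+ u * x3 ^+ v) \is homog d.
  by move=> e; rewrite rpredN; apply: homog_mon.
case: j l => [|[|//]] [|[|[|//]]] _ _ /=.
- by have /= := @H 0%N 0%N 1%N _ erefl;
  rewrite !expr0 expr1 !mul1r; congr (_ \is homog _); lia.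
- by have /= := @homog_mon _ 0%N 1%N 0%N erefl;
  rewrite !expr0 expr1 mul1r mulr1; congr (_ \is homog _); lia.
- by have /= := @H 1%N 0%N 0%N _ erefl;
  rewrite !expr0 expr1 !mulr1; congr (_ \is homog _); lia.
- by have /= := @H m.+1 0%N 0%N _ erefl;
  rewrite !expr0 exprS !mulr1; congr (_ \is homog _); lia.
- by have /= := @homog_mon _ 0%N 0%N 1%N erefl;
  rewrite !expr0 expr1 !mul1r; congr (_ \is homog _); lia.
- by have /= := @H 0%N 1%N 0%N _ erefl;
  rewrite !expr0 expr1 mul1r mulr1; congr (_ \is homog _); lia.
Qed.

Lemma hb_degree_preserving : degree_preserving w (hb_cpx k m).
Proof.
split=> [j|i j l] a; rewrite mxE.
  by have /dhomogP H := homog_gen (ltn_ord j) => /H ->.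
case: i j l => [|i] j l; last by case: j.
have /dhomogP H := homog_entry (ltn_ord j) (ltn_ord l) => /H -> /=.
(* The subtraction in [homog_entry] is truncated; it is exact because 2 + l <= 4 <= 4 + j. *)
apply/esym/subzn; have l2 : (l <= 2)%N by have := ltn_ord l.
apply: leq_add => //; apply: leq_mul => //.
exact: leq_trans (leq_add (leqnn 2) l2) (leq_addr _ _).
Qed.

(** Each entry is zero or, up to sign, a nonconstant monomial. *)
Lemma hb_minimal : minimal_cpx (hb_cpx k m).
Proof.
case=> [|i] j l; rewrite mxE; last by rewrite mcoeff0.
have mX a : a != @mnm0 3 -> mcoeff (@mnm0 3) (mpolyX k a) = 0.
  by rewrite mcoeffX => /negPf ->.
have x1y : x1 * x1 ^+ m = mpolyX k (mon3 m.+1 0 0).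
  by rewrite mpolyX_mon3 exprS !mulr1.
case: j l => -[|[|//]] hj [[|[|[|//]]] hl] /=; rewrite ?x1y ?mcoeffN mX ?oppr0 //.
all: apply/eqP => /(congr1 (fun a : multinom 3 => (a i1 + a i2 + a i3)%N)).
all: by rewrite ?mon3E ?mnm1E ?mnm0E.
Qed.

Hypothesis gcd3m : gcdn 3 m = 1%N.

(** The second syzygy has degree 9 + 5 m and sits in homological degree 1, whence 9 + 5 m - 1. *)
Lemma regularity_ge (R : realType) :
  ((8 + 5 * m)%:R%:E <= regularity w R (curve_ideal k m))%E.
Proof.
apply: ereal_sup_ubound; exists (hb_cpx k m), 1%N, (ord_max : 'I_2); split.
  by split; [exact: hb_degree_preserving|exact: hb_resolves|exact: hb_minimal].
congr (_%:E); rewrite -pmulrn /=; congr (_%:~R).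
Qed.

Lemma symbolic_pow_f1 s : symbolic_pow (curve_ideal k m) s (f1 k ^+ s).
Proof.
exists (f1 k ^+ s), 1; split.
- have := ideal_powX (@curve_idealM k m) s (ideal_pow1 (curve_f1 k m)).
  by rewrite mul1n.
- by rewrite /curve_ideal /= curve1 => /eqP; rewrite oner_eq0.
- by rewrite rmorph1 divr1.
Qed.

Lemma alpha_le s : (alpha w (symbolic_pow (curve_ideal k m) s) <= (6 + 2 * m) * s)%N.
Proof.
(* The second case is the default value 0, which satisfies the bound. *)
rewrite /alpha; case: xgetP => [d _ [_ H]|_ //].
apply: H; exists (f1 k ^+ s); split; first exact: symbolic_pow_f1.
  by rewrite expf_neq0 // f1_neq0.
by apply: dhomogMn; apply: (@homog_gen 0).
Qed.

Lemma waldschmidt_bounds (R : realType) :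
  0 <= waldschmidt w R (curve_ideal k m) <= (6 + 2 * m)%:R.
Proof.
rewrite /waldschmidt; set u := (fun s : nat => _).
(* A divergent sequence has the default limit 0, which satisfies both bounds. *)
have [cu|/dvgP ->] := pselect (cvgn u); last by rewrite lexx ler0n.
apply/andP; split.
  by apply: limr_ge => //; near=> s; rewrite divr_ge0.
apply: limr_le => //; near=> s; rewrite /u.
(* The term of index 0 is a division by 0, hence 0. *)
have [->|s0] := posnP s; first by rewrite invr0 mulr0 ler0n.
by rewrite ler_pdivrMr ?ltr0n // -natrM ler_nat alpha_le.
Unshelve. all: by end_near.
Qed.

End Invariants.

Theorem theorem7p19 (R : realType) (k : fieldType) (m : nat)
    (hm : (1 <= m)%N) (hgcd : gcdn 3 m = 1%N) :
  (resurgence R (curve_ideal k m)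
     <= regularity (curve_wt m) R (curve_ideal k m)
          / (waldschmidt (curve_wt m) R (curve_ideal k m))%:E)%E.
Proof.
have /andP[g0 gle] := waldschmidt_bounds k m R.
have g1 : (0 : R) < (6 + 2 * m)%:R by rewrite ltr0n.
apply: le_trans (resurgence_le k hgcd R) _.
apply: (@le_trans _ _ ((8 + 5 * m)%:R%:E * ((6 + 2 * m)%:R%:E)^-1)%E).
  (* The inequality amounts to 4 (6 + 2 m) <= 3 (8 + 5 m), that is 8 m <= 15 m. *)
  rewrite inver gt_eqF // lee_fin ler_pdivlMr // mulrAC ler_pdivrMr ?ltr0n //.
  by rewrite -!natrM ler_nat; lia.
(* The regularity is bounded from below, and inversion reverses the upper bound on gamma. *)
apply: lee_pmul.
- by rewrite lee_fin ler0n.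
- by rewrite inve_ge0 lee_fin ltW.
- exact: regularity_ge.
- by rewrite lee_pV2 ?inE ?lee_fin // ltW.
Qed.
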